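(* Consider the problem of maximizing $$\int_0^T\big[-\langle c,\rho^2(t)\rangle+\langle p(t),S(I(t),p(t))\rangle\big]\,\sigma(t)\,dt$$ over $(p,I,\rho)$ subject to $\frac{dI}{dt}=-S(I,p)\,\sigma+\rho^2\sigma$ and boundary constraints on $I(0)$, $I(T)$, in either of the two cases: (CR) $\rho_i\neq0$ for all $i$; (MD) $\rho_i=0$ for all $i$. (i) For the exponential model $\log S=\log S_0+\alpha\log I+\Gamma p$ with constant matrices $\alpha$ and $\Gamma$, the quantity $\langle S,\Gamma^{-1}1_n\rangle$ is constant on an optimal price/inventory trajectory in both cases (MD) and (CR). (ii) In particular, for the one-dimensional exponential model $S=S_0I^{\alpha}e^{\gamma p}$ an optimal price/inventory policy maintains the de-seasoned rate of sales $S$ constant. (iii) For the one-dimensional constant elasticity model $S=S_0I^{\alpha}p^{\gamma}$ an optimal price/inventory policy maintains the de-seasoned revenue rate $R=pS$ constant.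
   Context: There are $n$ items and a time interval $[0,T]$. $I(t)=(I_1,\dots,I_n)$ is inventory, $p(t)=(p_1,\dots,p_n)$ price, $S=S(I,p)$ the rate of sales (demand), $R=pS$ the revenue rate, $c=(c_1,\dots,c_n)$, $c_i\ge0$, the constant unit cost, and $\rho^2=(\rho_1^2,\dots,\rho_n^2)$ the de-seasoned replenishment rate. $\sigma(t)$ is a known probability density on $[0,T]$ (''seasonality''); ''de-seasoned'' means the rate without the factor $\sigma$. In case (MD) the problem is to maximize $\int_0^T\langle p,S\rangle\sigma\,dt$ subject to $\frac{dI}{dt}=-S\sigma$, $I(0)=I_0$, $I(T)=0$. The conditions on $\rho$ in (CR) and (MD) hold at all times. Products, squares and logarithms of vectors are componentwise; $\langle\cdot,\cdot\rangle$ is the standard scalar product; $1_n$ is the $n$-vector with all coordinates $1$. $S_0$ is a constant positive vector (a positive number when $n=1$). In the exponential model the matrix $\Gamma$ is the constant exponent matrix (the elasticity matrix $S_i^{-1}\frac{\partial S_i}{\partial p_j}p_j$ of this model is $\Gamma\,\mathrm{diag}(p)$). In the one-dimensional models $\alpha,\gamma$ are real constants. Standing assumptions: trajectories are sufficiently regular; $I,p,S$ are positive along the trajectory (in the interior of the time interval); $\Gamma$ is invertible ($\gamma\neq0$ when $n=1$); and the Lagrange multiplier rule applies, i.e. an optimal trajectory admits a differentiable multiplier $\lambda(t)\in\mathbb R^n$ satisfying the Euler–Lagrange equations of the Lagrangian $L=-\langle c,\rho^2\rangle\sigma+\langle p,S\rangle\sigma+\langle\lambda,\tfrac{dI}{dt}+S\sigma-\rho^2\sigma\rangle$,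 namely $(c+\lambda)\rho=0$ (componentwise), $p+\lambda=-[(\partial S/\partial p)^T]^{-1}S$, and $\dot\lambda=\sigma(\partial S/\partial I)^T(p+\lambda)$. *)

(* Defs.v *)
From mathcomp Require Import all_boot all_order all_algebra.
From mathcomp Require Import all_classical all_reals all_analysis.

Set Implicit Arguments.
Unset Strict Implicit.
Unset Printing Implicit Defensive.

Import Order.TTheory GRing.Theory Num.Theory.
Import numFieldNormedType.Exports.

Local Open Scope classical_set_scope.
Local Open Scope ring_scope.

(* Item-indexed quantities are column vectors; products, squares, logarithms
   and order relations are componentwise. *)

Definition inner (R : realType) (n : nat) (u v : 'cV[R]_n) : R :=
  \sum_i u i 0 * v i 0.

Definition vmul (R : realType) (n : nat) (u v : 'cV[R]_n) : 'cV[R]_n :=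
  \col_i (u i 0 * v i 0).

Definition vsqr (R : realType) (n : nat) (u : 'cV[R]_n) : 'cV[R]_n := vmul u u.

Definition vpos (R : realType) (n : nat) (u : 'cV[R]_n) : Prop :=
  forall i, 0 < u i 0.

Definition vnneg (R : realType) (n : nat) (u : 'cV[R]_n) : Prop :=
  forall i, 0 <= u i 0.

(* Entry (i, j) is the partial derivative of the i-th component in the j-th
   coordinate.  The library's jacobian is the transpose of this matrix, for
   row vectors. *)
Definition partial_mx (R : realType) (n : nat) (f : 'cV[R]_n -> 'cV[R]_n)
    (a : 'cV[R]_n) : 'M[R]_n :=
  \matrix_(i, j) 'D_(delta_mx j 0) (fun x : 'cV[R]_n => f x i 0) a.

Definition probability_density (R : realType) (T : R) (sigma : R -> R) : Prop :=
  [/\ measurable_fun `[0, T] sigma,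
      forall t, t \in `[0, T] -> 0 <= sigma t &
      (\int[@lebesgue_measure R]_(t in `[0%R, T]) (sigma t)%:E = 1)%E].

(* The two cases.  In CR the constraint on (I(0), I(T)) is arbitrary; in MD the
   argument is the prescribed initial inventory, and the final one is 0. *)
Inductive regime (R : realType) (n : nat) : Type :=
  | CR of ('cV[R]_n -> 'cV[R]_n -> Prop)
  | MD of 'cV[R]_n.

Definition boundary_constraint (R : realType) (n : nat) (k : regime R n)
    (I0 IT : 'cV[R]_n) : Prop :=
  match k with
  | CR B => B I0 IT
  | MD J0 => I0 = J0 /\ IT = 0
  end.

Definition replenishment_constraint (R : realType) (n : nat) (k : regime R n)
    (r : 'cV[R]_n) : Prop :=
  match k with
  | CR _ => forall i, r i 0 != 0
  | MD _ => forall i, r i 0 = 0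
  end.

(* rho is the componentwise square root (of either sign) of the de-seasoned
   replenishment rate. *)
Record trajectory (R : realType) (n : nat) : Type := Trajectory {
  price : R -> 'cV[R]_n ;
  inventory : R -> 'cV[R]_n ;
  rho : R -> 'cV[R]_n }.

Definition sales (R : realType) (n : nat)
    (S : 'cV[R]_n -> 'cV[R]_n -> 'cV[R]_n) (z : trajectory R n) (t : R) :
    'cV[R]_n :=
  S (inventory z t) (price z t).

Definition running_profit (R : realType) (n : nat) (sigma : R -> R)
    (c : 'cV[R]_n) (S : 'cV[R]_n -> 'cV[R]_n -> 'cV[R]_n)
    (z : trajectory R n) (t : R) : R :=
  (- inner c (vsqr (rho z t)) + inner (price z t) (sales S z t)) * sigma t.

Definition profit (R : realType) (n : nat) (T : R) (sigma : R -> R)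
    (c : 'cV[R]_n) (S : 'cV[R]_n -> 'cV[R]_n -> 'cV[R]_n)
    (z : trajectory R n) : \bar R :=
  (\int[@lebesgue_measure R]_(t in `[0%R, T])
     (running_profit sigma c S z t)%:E)%E.

(* Prices and sales need not extend to the endpoints (with I(T) = 0 an optimal
   price may blow up at T), hence the open interval in the regularity,
   positivity and dynamics clauses. *)
Definition admissible (R : realType) (n : nat) (T : R) (sigma : R -> R)
    (c : 'cV[R]_n) (S : 'cV[R]_n -> 'cV[R]_n -> 'cV[R]_n) (k : regime R n)
    (z : trajectory R n) : Prop :=
  [/\ {within `[0, T], continuous (inventory z)},
      forall i, measurable_fun `[0, T] (fun t => rho z t i 0) &
      (@lebesgue_measure R).-integrable `[0, T]
        (EFin \o running_profit sigma c S z)] /\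
  [/\ boundary_constraint k (inventory z 0) (inventory z T),
      forall t, t \in `[0, T] -> replenishment_constraint k (rho z t) &
      forall t, t \in `]0, T[ ->
        [/\ vpos (inventory z t), vpos (price z t), vpos (sales S z t),
            derivable (price z) t 1 &
            is_derive t 1 (inventory z)
              (- (sigma t *: sales S z t) + sigma t *: vsqr (rho z t))]].

Definition optimal (R : realType) (n : nat) (T : R) (sigma : R -> R)
    (c : 'cV[R]_n) (S : 'cV[R]_n -> 'cV[R]_n -> 'cV[R]_n) (k : regime R n)
    (z : trajectory R n) : Prop :=
  admissible T sigma c S k z /\
  forall y, admissible T sigma c S k y ->
    (profit T sigma c S y <= profit T sigma c S z)%E.

(* Euler-Lagrange equations, in this order, of the variables rho, p and I for
   L = - <c, rho^2> sigma + <p, S> sigma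
       + <lambda, dI/dt + S sigma - rho^2 sigma>. *)
Definition euler_lagrange (R : realType) (n : nat) (T : R) (sigma : R -> R)
    (c : 'cV[R]_n) (S : 'cV[R]_n -> 'cV[R]_n -> 'cV[R]_n)
    (z : trajectory R n) (lambda : R -> 'cV[R]_n) : Prop :=
  forall t, t \in `]0, T[ ->
    let I := inventory z t in
    let p := price z t in
    [/\ vmul (c + lambda t) (rho z t) = 0,
        p + lambda t = - (invmx (partial_mx (S I) p)^T *m S I p) &
        is_derive t 1 lambda
          (sigma t *: ((partial_mx (S^~ p) I)^T *m (p + lambda t)))].

(* log S = log S0 + alpha log I + Gamma p *)
Definition exponential_demand (R : realType) (n : nat) (S0 : 'cV[R]_n)
    (alpha Gamma : 'M[R]_n) (I p : 'cV[R]_n) : 'cV[R]_n :=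
  map_mx expR (map_mx (@ln R) S0 + alpha *m map_mx (@ln R) I + Gamma *m p).

Definition exponential_demand1 (R : realType) (S0 alpha gamma : R)
    (I p : 'cV[R]_1) : 'cV[R]_1 :=
  const_mx (S0 * (I 0 0) `^ alpha * expR (gamma * p 0 0)).

Definition constant_elasticity_demand1 (R : realType) (S0 alpha gamma : R)
    (I p : 'cV[R]_1) : 'cV[R]_1 :=
  const_mx (S0 * (I 0 0) `^ alpha * (p 0 0) `^ gamma).

(* Main.v *)
(** Write u = p + lambda.  The quantity <S, u> is conserved for every demand
    function: along an optimal trajectory S' = S_I I' + S_p p', and since
    S_p^T u = - S, lambda' = sigma S_I^T u and I' = sigma (rho^2 - S), all terms
    of <S', u> + <S, p' + lambda'> cancel except <lambda', rho^2>.  The latter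
    vanishes because rho = 0 (MD) or because lambda = - c is constant (CR).
    Solving S_p^T u = - S turns <S, u> into - <S, Gamma^-1 1_n>, - S / gamma and
    - p S / gamma in the three models. *)

Require Import Defs.
From mathcomp Require Import all_boot all_order all_algebra.
From mathcomp Require Import all_classical all_reals all_analysis.
From mathcomp Require Import ring lra.

Set Implicit Arguments.
Unset Strict Implicit.
Unset Printing Implicit Defensive.

Import Order.TTheory GRing.Theory Num.Theory.
Import numFieldNormedType.Exports.

Local Open Scope classical_set_scope.
Local Open Scope ring_scope.

(** * Derivatives of matrix-valued functions and of inner products *)

Section Calculus.
Context {R : realType}.

Lemma is_derive_mx_entry (V : normedModType R) (m n : nat)
    (f : V -> 'M[R]_(m, n)) (a v : V) (df : 'M[R]_(m, n)) i j :
  is_derive a v f df -> is_derive a v (fun x => f x i j) (df i j).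
Proof.
move=> [fav <-]; apply: DeriveDef; first exact: (derivable_mxP f a v).1.
by rewrite derive_mx// mxE.
Qed.

Lemma is_derive_mxP (V : normedModType R) (m n : nat)
    (f : V -> 'M[R]_(m, n)) (a v : V) (df : 'M[R]_(m, n)) :
  (forall i j, is_derive a v (fun x => f x i j) (df i j)) ->
  is_derive a v f df.
Proof.
move=> dfE.
have fav : derivable f a v by apply/derivable_mxP => i j; case: (dfE i j).
apply: DeriveDef => //; rewrite derive_mx//.
by apply/matrixP => i j; rewrite mxE derive_val.
Qed.

(** Both sides are limits of the same difference quotient. This turns the entries of [partial_mx]
    into derivatives along a curve. *)
Lemma derive_along_line (V W : normedModType R) (f : V -> W) (a v : V) :
  'D_v f a = 'D_1 (fun h : R => f (h *: v + a)) 0.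
Proof.
apply: (congr1 (fun g : R -> W => lim (g @ 0^'))); apply/funext => h /=.
by rewrite addr0 scale0r add0r [h *: 1]mulr1.
Qed.

Lemma is_derive_line (V : normedModType R) (a v : V) :
  is_derive (0 : R) 1 (fun h : R => h *: v + a) v.
Proof.
have dvE : derivable (fun h : R => h *: v + a) 0 1 /\
    'D_1 (fun h : R => h *: v + a) 0 = v.
  have vE : (fun h : R => h^-1 *: (((fun h : R => h *: v + a) \o shift 0)
      (h *: 1) - (0 *: v + a))) @ 0^' --> v.
    (* For [h != 0] the difference quotient is exactly [v]. *)
    have : cst v @ (0 : R)^' --> v by exact: cvg_cst.
    apply: cvg_trans; apply: near_eq_cvg; near=> h => /=.
    have h_neq0 : h != 0 by near: h; exact: nbhs_dnbhs_neq.
    rewrite addr0 scale0r add0r [h *: 1]mulr1 addrK scalerA mulVf//.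
    by rewrite scale1r.
  by split; [exact: cvgP vE | exact: cvg_lim vE].
by case: dvE => ? ?; exact: DeriveDef.
Unshelve. all: by end_near. Qed.

(** The mean value theorem is applied on closed subintervals only, so [f] may be arbitrary at [a]
    and [b], where prices can blow up. The midpoint serves as the reference point. *)
Lemma derive_0_cst_oo (a b : R) (f : R -> R) :
  (forall t, t \in `]a, b[ -> is_derive t 1 f 0) ->
  exists C, forall t, t \in `]a, b[ -> f t = C.
Proof.
move=> df0; exists (f ((a + b) / 2)) => t tab.
have mab : (a + b) / 2 \in `]a, b[.
  by move: tab; rewrite !in_itv/= => /andP[? ?]; apply/andP; split; lra.
have le_eq x y : x \in `]a, b[ -> y \in `]a, b[ -> x <= y -> f y = f x.
  move=> xab yab xy.
  have sub z : z \in `[x, y] -> z \in `]a, b[.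
    move: xab yab; rewrite !in_itv/= => /andP[? ?] /andP[? ?] /andP[? ?].
    by apply/andP; split; lra.
  have cf : {within `[x, y], continuous f}.
    apply: derivable_within_continuous => z zxy.
    by case: (df0 z (sub z zxy)).
  have df0' z : z \in `]x, y[ -> is_derive z 1 f ((fun=> 0) z).
    by move=> zxy; apply/df0/sub/subset_itv_oo_cc.
  have [z _ /eqP] := MVT_segment xy df0' cf.
  by rewrite mul0r subr_eq0 => /eqP.
by have [le_tm|/ltW le_mt] := leP t ((a + b) / 2); [symmetry|]; exact: le_eq.
Qed.

Lemma is_derive_inner (n : nat) (u v : R -> 'cV[R]_n) (du dv : 'cV[R]_n)
    (t : R) :
  is_derive t 1 u du -> is_derive t 1 v dv ->
  is_derive t 1 (fun x => inner (u x) (v x)) (inner du (v t) + inner (u t) dv).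
Proof.
move=> du_ dv_; rewrite /inner -big_split/=.
have -> : (fun x => \sum_i u x i 0 * v x i 0) =
    \sum_(i < n) ((fun x => u x i 0) * (fun x => v x i 0)).
  by apply/funext => x; rewrite fct_sumE.
apply: is_derive_sum => i.
have dui := is_derive_mx_entry i 0 du_; have dvi := is_derive_mx_entry i 0 dv_.
apply: is_derive_eq; rewrite addrC mulrC; congr (_ + _); exact: mulrC.
Qed.

End Calculus.

Section Inner.
Context {R : realType} {n : nat}.
Implicit Types u v w : 'cV[R]_n.

Lemma innerE u v : inner u v = (u^T *m v) 0 0.
Proof. by rewrite mxE; apply: eq_bigr => i _; rewrite mxE. Qed.

Lemma innerC u v : inner u v = inner v u.
Proof. by apply: eq_bigr => i _; rewrite mulrC. Qed.

Lemma innerDl u v w : inner (u + v) w = inner u w + inner v w.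
Proof. by rewrite !innerE linearD mulmxDl mxE. Qed.

Lemma innerNl u w : inner (- u) w = - inner u w.
Proof. by rewrite !innerE linearN mulNmx mxE. Qed.

Lemma innerZl a u w : inner (a *: u) w = a * inner u w.
Proof. by rewrite !innerE linearZ -scalemxAl mxE. Qed.

Lemma inner0l w : inner 0 w = 0.
Proof. by rewrite !innerE linear0 mul0mx mxE. Qed.

Lemma inner_mulmxl (A : 'M[R]_n) u v : inner (A *m u) v = inner u (A^T *m v).
Proof. by rewrite !innerE trmx_mul mulmxA. Qed.

End Inner.

(* The chain rule along curves.  Along lines in one argument, with the other
   one fixed, it identifies [SI] and [Sp] with the partial derivative
   matrices, so no separate differentiability assumption on [S] is needed. *)
Definition has_partials (R : realType) (n : nat)
    (S : 'cV[R]_n -> 'cV[R]_n -> 'cV[R]_n)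
    (SI Sp : 'cV[R]_n -> 'cV[R]_n -> 'M[R]_n) : Prop :=
  forall (I p : R -> 'cV[R]_n) (dI dp : 'cV[R]_n) (t : R),
    vpos (I t) -> vpos (p t) -> is_derive t 1 I dI -> is_derive t 1 p dp ->
    is_derive t 1 (fun x => S (I x) (p x))
      (SI (I t) (p t) *m dI + Sp (I t) (p t) *m dp).

(** * Conservation of sales times markup for a general demand function *)

Section Conservation.
Context {R : realType} {n : nat}.
Variables (S : 'cV[R]_n -> 'cV[R]_n -> 'cV[R]_n).
Variables (SI Sp : 'cV[R]_n -> 'cV[R]_n -> 'M[R]_n).
Hypothesis S_partials : has_partials S SI Sp.

Lemma partial_mx_price I p : vpos I -> vpos p -> partial_mx (S I) p = Sp I p.
Proof.
move=> I_gt0 p_gt0; apply/matrixP => i j; rewrite mxE derive_along_line.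
have dp := is_derive_line p (delta_mx j 0).
(* Freezing the inventory kills the [SI] term, and the direction [delta_mx j 0] selects column [j]
   of [Sp]. *)
have := S_partials (I := cst I) (dI := 0) I_gt0 _ (is_derive_cst _ _ _) dp.
rewrite /= scale0r add0r => /(_ p_gt0)/(is_derive_mx_entry i 0)[_ ->].
by rewrite mulmx0 add0r -colE mxE.
Qed.

Lemma partial_mx_inventory I p :
  vpos I -> vpos p -> partial_mx (S^~ p) I = SI I p.
Proof.
move=> I_gt0 p_gt0; apply/matrixP => i j; rewrite mxE derive_along_line.
have dI := is_derive_line I (delta_mx j 0).
have := S_partials (p := cst p) (dp := 0) _ p_gt0 dI (is_derive_cst _ _ _).
rewrite /= scale0r add0r => /(_ I_gt0)/(is_derive_mx_entry i 0)[_ ->].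
by rewrite mulmx0 addr0 -colE mxE.
Qed.

Variables (T : R) (sigma : R -> R) (c : 'cV[R]_n) (k : regime R n).
Variables (z : trajectory R n) (lambda : R -> 'cV[R]_n).
Hypothesis z_adm : admissible T sigma c S k z.
Hypothesis z_EL : euler_lagrange T sigma c S z lambda.

(* Under CR the multiplier is the constant [- c]; under MD, [rho = 0]. *)
Lemma multiplier_replenishment_orthogonal t dlambda : t \in `]0, T[ ->
  is_derive t 1 lambda dlambda -> inner dlambda (vsqr (rho z t)) = 0.
Proof.
move=> t0T dl.
have t0T' : t \in `[0, T] by exact: subset_itv_oo_cc.
case: z_adm => _ [_ rho_k _].
have nearT : \near t, t \in `]0, T[ by exact: near_in_itvoo.
have := rho_k; case: (k) => [B|J] /= {}rho_k.
  (* As [rho] has no zero component, [(c + lambda) rho = 0] forces [lambda = - c] on a whole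
     neighbourhood of [t], hence a zero derivative there. *)
  have dl0 : is_derive t 1 lambda 0.
    have : is_derive t 1 (cst (- c) : R -> 'cV[R]_n) 0 by exact: is_derive_cst.
    apply: near_eq_is_derive; near=> s.
    have s0T : s \in `]0, T[ by near: s.
    have [rhos _ _] := z_EL s0T.
    apply/colP => i; move/colP/(_ i): rhos; rewrite !mxE => /eqP.
    rewrite mulf_eq0 (negPf (rho_k _ _ _)) ?orbF ?addr_eq0 //.
      by move=> /eqP ->; rewrite opprK.
    exact: subset_itv_oo_cc.
  by case: dl => _ <-; case: dl0 => _ ->; rewrite inner0l.
rewrite innerC; suff -> : vsqr (rho z t) = 0 by rewrite inner0l.
by apply/colP => i; rewrite !mxE rho_k// mul0r.
Unshelve. all: by end_near. Qed.

Hypothesis Sp_unit : forall t, t \in `]0, T[ ->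
  Sp (inventory z t) (price z t) \in unitmx.

(** The first conjunct is the price equation cleared of its inverse; each demand model uses it to
    identify the conserved quantity. *)
Lemma sales_markup_conserved :
  (forall t, t \in `]0, T[ ->
    (Sp (inventory z t) (price z t))^T *m (price z t + lambda t)
      = - sales S z t) /\
  exists C, forall t, t \in `]0, T[ ->
    inner (sales S z t) (price z t + lambda t) = C.
Proof.
have SpTu t : t \in `]0, T[ ->
    (Sp (inventory z t) (price z t))^T *m (price z t + lambda t)
      = - sales S z t.
  move=> t0T; have [_ -> _] := z_EL t0T.
  case: z_adm => _ [_ _ /(_ t t0T)[I_gt0 p_gt0 _ _ _]].
  by rewrite partial_mx_price// mulmxN mulKVmx// unitmx_tr Sp_unit.
split=> //; apply: derive_0_cst_oo => t t0T.
have [_ _ dl] := z_EL t0T.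
case: z_adm => _ [_ _ /(_ t t0T)[I_gt0 p_gt0 _ dp dI]].
(* The price derivative stays abstract: [Sp^T u = - S] makes its two contributions cancel. *)
move/derivableP: dp => dp.
have dS := S_partials I_gt0 p_gt0 dI dp.
have du := is_deriveD dp dl.
apply: is_derive_eq (is_derive_inner dS du) _.
have orth := multiplier_replenishment_orthogonal t0T dl.
have SpTut := SpTu t t0T.
move: orth; rewrite partial_mx_inventory//.
set u := price z t + lambda t in SpTut *.
(* With the partials abstracted to [A] and [B], moving them across the inner product leaves only
   terms governed by [B^T u = - S] and by [orth]. *)
move: (SI _ _) (Sp _ _) SpTut => A B SpTut orth.
rewrite -/(sales S z t) -[(price z + lambda) t]/u.
rewrite innerDl !inner_mulmxl SpTut innerDl innerNl !innerZl.
rewrite !(innerC _ (- sales S z t)) !(innerC (sales S z t)) innerNl innerDl.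
rewrite innerZl innerZl in orth *.
rewrite (innerC (vsqr _)) (innerC (sales S z t)) orth; ring.
Qed.

End Conservation.

(** * Partial derivatives of the three demand functions *)

Section DemandModels.
Context {R : realType}.

Lemma exponential_demand_gt0 (n : nat) (S0 : 'cV[R]_n) (alpha Gamma : 'M[R]_n)
    I p : vpos (exponential_demand S0 alpha Gamma I p).
Proof. by move=> i; rewrite mxE expR_gt0. Qed.

(** Each component is the exponential of an exponent affine in [log I] and [p], so the chain rule
    gives [diag(S) alpha diag(I)^-1] and [diag(S) Gamma]. *)
Lemma exponential_demand_partials (n : nat) (S0 : 'cV[R]_n)
    (alpha Gamma : 'M[R]_n) (S := exponential_demand S0 alpha Gamma) :
  has_partials S (fun I p => \matrix_(i, j) (S I p i 0 * (alpha i j / I j 0)))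
    (fun I p => diag_mx (S I p)^T *m Gamma).
Proof.
move=> I p dI dp t I_gt0 p_gt0 dI_ dp_; apply: is_derive_mxP => i j.
rewrite (ord1 j).
pose e := cst (ln (S0 i 0))
  + \sum_(l < n) (alpha i l \*: ((@ln R) \o (fun x => I x l 0)))
  + \sum_(l < n) (Gamma i l \*: (fun x => p x l 0)).
have SE x : S (I x) (p x) i 0 = expR (e x).
  rewrite !mxE /e !fctE !fct_sumE.
  by congr (expR (_ + _ + _)); apply: eq_bigr => l _; rewrite !mxE.
rewrite (_ : (fun x => _) = expR \o e); last by apply/funext => x; rewrite SE.
have dln l : is_derive t 1 (alpha i l \*: ((@ln R) \o (fun x => I x l 0)))
    (alpha i l *: ((I t l 0)^-1 * dI l 0)).
  apply/is_deriveZ/is_derive1_comp; first exact: is_derive1_ln (I_gt0 l).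
  exact: is_derive_mx_entry.
have dlin l : is_derive t 1 (Gamma i l \*: (fun x => p x l 0))
    (Gamma i l *: dp l 0).
  by apply: is_deriveZ; exact: is_derive_mx_entry.
have de := is_deriveD (is_deriveD (is_derive_cst (ln (S0 i 0)) t 1)
  (is_derive_sum dln)) (is_derive_sum dlin).
apply: is_derive_eq (is_derive1_comp (is_derive_expR _) de) _.
rewrite -SE add0r mulrDr [RHS]mxE; congr (_ + _).
  rewrite [RHS]mxE mulr_sumr; apply: eq_bigr => l _; rewrite [in RHS]mxE.
  by rewrite /GRing.scale/= !mulrA.
by rewrite -mulmxA mul_diag_mx !mxE.
Qed.

(** Lets the derivative of a power be written as the power itself times [a / x], as in the
    logarithmic form of the partials below. *)
Lemma powR_subr1 (x a : R) : 0 < x -> x `^ (a - 1) = x `^ a / x.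
Proof. by move=> x_gt0; rewrite powRB ?(gt_eqF x_gt0) ?implybT// powRr1// ltW. Qed.

Lemma exponential_demand1_partials (S0 alpha gamma : R)
    (S := exponential_demand1 S0 alpha gamma) :
  has_partials S (fun I p => (S I p 0 0 * alpha / I 0 0)%:M)
    (fun I p => (S I p 0 0 * gamma)%:M).
Proof.
move=> I p dI dp t I_gt0 p_gt0 dI_ dp_; apply: is_derive_mxP => i j.
rewrite (ord1 i) (ord1 j) !mul_scalar_mx.
have dI00 := is_derive_mx_entry 0 0 dI_; have dp00 := is_derive_mx_entry 0 0 dp_.
have dpow := is_derive1_comp (is_derive1_powR alpha (I_gt0 0)) dI00.
have dexp := is_derive1_comp (is_derive_expR _) (is_deriveZ gamma dp00).
rewrite (_ : (fun x => _) = (S0 \*: (fun x => I x 0 0 `^ alpha))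
    * (expR \o (gamma \*: (fun x => p x 0 0)))); last first.
  by apply/funext => x; rewrite !mxE.
apply: is_derive_eq (is_deriveM (is_deriveZ S0 dpow) dexp) _.
rewrite !mxE powR_subr1// /= /GRing.scale/=.
by field; exact: lt0r_neq0.
Qed.

Lemma constant_elasticity_demand1_partials (S0 alpha gamma : R)
    (S := constant_elasticity_demand1 S0 alpha gamma) :
  has_partials S (fun I p => (S I p 0 0 * alpha / I 0 0)%:M)
    (fun I p => (S I p 0 0 * gamma / p 0 0)%:M).
Proof.
move=> I p dI dp t I_gt0 p_gt0 dI_ dp_; apply: is_derive_mxP => i j.
rewrite (ord1 i) (ord1 j) !mul_scalar_mx.
have dI00 := is_derive_mx_entry 0 0 dI_; have dp00 := is_derive_mx_entry 0 0 dp_.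
have dpowI := is_derive1_comp (is_derive1_powR alpha (I_gt0 0)) dI00.
have dpowp := is_derive1_comp (is_derive1_powR gamma (p_gt0 0)) dp00.
rewrite (_ : (fun x => _) = (S0 \*: (fun x => I x 0 0 `^ alpha))
    * (fun x => p x 0 0 `^ gamma)); last first.
  by apply/funext => x; rewrite !mxE.
apply: is_derive_eq (is_deriveM (is_deriveZ S0 dpowI) dpowp) _.
rewrite !mxE !powR_subr1// /= /GRing.scale/=.
by field; rewrite !lt0r_neq0.
Qed.

End DemandModels.

(** * The conserved quantity in each model *)

Theorem corollary3 (R : realType) (T : R) (sigma : R -> R)
    (T_gt0 : 0 < T) (sigma_density : probability_density T sigma) :
  [/\ forall (n : nat) (c S0 : 'cV[R]_n) (alpha Gamma : 'M[R]_n)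
        (k : regime R n) (z : trajectory R n),
        let S := exponential_demand S0 alpha Gamma in
        vnneg c -> vpos S0 -> Gamma \in unitmx ->
        optimal T sigma c S k z ->
        (exists lambda, euler_lagrange T sigma c S z lambda) ->
        exists C : R, forall t, t \in `]0, T[ ->
          inner (sales S z t) (invmx Gamma *m const_mx 1) = C,
      forall (c : 'cV[R]_1) (S0 alpha gamma : R)
        (k : regime R 1) (z : trajectory R 1),
        let S := exponential_demand1 S0 alpha gamma in
        vnneg c -> 0 < S0 -> gamma != 0 ->
        optimal T sigma c S k z ->
        (exists lambda, euler_lagrange T sigma c S z lambda) ->
        exists C : R, forall t, t \in `]0, T[ ->
          sales S z t 0 0 = C &
      forall (c : 'cV[R]_1) (S0 alpha gamma : R)
        (k : regime R 1) (z : trajectory R 1),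
        let S := constant_elasticity_demand1 S0 alpha gamma in
        vnneg c -> 0 < S0 -> gamma != 0 ->
        optimal T sigma c S k z ->
        (exists lambda, euler_lagrange T sigma c S z lambda) ->
        exists C : R, forall t, t \in `]0, T[ ->
          price z t 0 0 * sales S z t 0 0 = C].
Proof.
split=> [n c S0 alpha Gamma k z S _ _ Gamma_unit [z_adm _] [lambda z_EL]|
         c S0 alpha gamma k z S _ _ gamma_neq0 [z_adm _] [lambda z_EL]|
         c S0 alpha gamma k z S _ _ gamma_neq0 [z_adm _] [lambda z_EL]].
- have S_gt0 t : vpos (sales S z t) by exact: exponential_demand_gt0.
  have [|SpTu [C SuC]] := sales_markup_conserved
    (@exponential_demand_partials _ _ S0 alpha Gamma) z_adm z_EL.
    (* The determinant of [diag(S)] is a product of positive sales rates. *)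
    move=> t _; rewrite unitmx_mul Gamma_unit andbT unitmxE det_diag unitfE.
    by apply/prodf_neq0 => i _; rewrite mxE; exact: lt0r_neq0 (S_gt0 t i).
  (* Replacing [S] by [- Sp^T u] and moving [Sp = diag(S) Gamma] across gives
     [- <u, diag(S) 1> = - <u, S>]. *)
  exists (- C) => t t0T; rewrite -(SuC t t0T) -[sales S z t in LHS]opprK -SpTu//.
  rewrite innerNl inner_mulmxl trmxK -mulmxA mulKVmx//; congr (- _).
  rewrite innerC mul_diag_mx; apply: eq_bigr => i _.
  by rewrite !mxE mulr1.
- have S_gt0 t : t \in `]0, T[ -> 0 < sales S z t 0 0.
    by case: z_adm => _ [_ _ adm] /adm[].
  have [t t0T|SpTu [C SuC]] := sales_markup_conserved
    (@exponential_demand1_partials _ S0 alpha gamma) z_adm z_EL.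
    by rewrite unitmxE det_scalar1 unitfE mulf_neq0// gt_eqF// S_gt0.
  (* Here [Sp = gamma S], so the price equation reads [gamma S u = - S], while [S u = C]. *)
  exists (- gamma * C) => t t0T.
  have := SpTu t t0T; rewrite -(SuC t t0T) /inner big_ord1.
  rewrite tr_scalar_mx mul_scalar_mx => /colP/(_ 0); rewrite -/S -/(sales S z t).
  move: (price z t + lambda t) => u; rewrite [LHS]mxE [RHS]mxE => Su.
  by rewrite mulNr mulrA [gamma * _]mulrC Su opprK.
- have S_gt0 t : t \in `]0, T[ -> 0 < sales S z t 0 0.
    by case: z_adm => _ [_ _ adm] /adm[].
  have p_gt0 t : t \in `]0, T[ -> 0 < price z t 0 0.
    by case: z_adm => _ [_ _ adm] /adm[].
  have [t t0T|SpTu [C SuC]] := sales_markup_conserved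
    (@constant_elasticity_demand1_partials _ S0 alpha gamma) z_adm z_EL.
    rewrite unitmxE det_scalar1 unitfE !mulf_neq0// ?invr_neq0 ?gt_eqF ?S_gt0//.
    exact: p_gt0.
  (* Here [Sp = gamma S / p], so the price equation reads [gamma S u = - p S], while [S u = C]. *)
  exists (- gamma * C) => t t0T; have pt_neq0 := lt0r_neq0 (p_gt0 t t0T).
  have := SpTu t t0T; rewrite -(SuC t t0T) /inner big_ord1.
  rewrite tr_scalar_mx mul_scalar_mx => /colP/(_ 0); rewrite -/S -/(sales S z t).
  move: (price z t + lambda t) => u; rewrite [LHS]mxE [RHS]mxE => Su.
  by rewrite -[sales S z t 0 0 in LHS]opprK -Su; field.
Qed.
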